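(* For every bounded sequence $(u_n)_{n \in \mathbb{N}}$ of complex numbers the inequality $$\limsup_{N \to \infty} \left|\frac{1}{N} \sum_{n=1}^N u_n\right|^2 \leq \liminf_{J \to \infty} \frac{1}{J}\sum_{j=1}^J \limsup_{N \to \infty} \frac{1}{N}\sum_{n=1}^{N} \operatorname{Re}\left(u_n \overline{u_{n+j}}\right)$$ holds.
   Context: $\mathbb{N} = \{1,2,3,\dots\}$. *)

(* Defs.v *)
From mathcomp Require Export all_boot all_order all_algebra.
From mathcomp Require Export complex.
From mathcomp Require Export all_classical all_reals all_analysis.

Set Implicit Arguments.
Unset Strict Implicit.
Unset Printing Implicit Defensive.

(* Main.v *)
Require Import Defs.
From mathcomp Require Import ring lra.
Import Order.TTheory GRing.Theory Num.Theory.
Local Open Scope ring_scope.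

Set Implicit Arguments.
Unset Strict Implicit.
Unset Printing Implicit Defensive.

(** Write [L] for the left-hand side, [T] for the shift, [<f, g>] for the upper
mean (the limsup over [N] of the mean over [n <= N]) of [Re (f n * (g n)^* )],
[c_j = <u, T^j u>], and [v_J] for the mean of [T u, ..., T^J u].

The usual van der Corput argument bounds [L] by the square mean of a single
[v_J].  Expanding that square gives the Fejer means of [c], which are averages
of the Cesaro means of [c]; this only bounds [L] by their limsup.  To reach the
liminf, suppose that the Cesaro means of [c] are at most [l] for infinitely
many [J], and pick such [J_1 << J_2 << ... << J_k].  Let
[V = (v_{J_1} + ... + v_{J_k}) / k].

- Means are insensitive to a bounded shift, so [u] and [V] have the same mean
  up to [O(1 / N)], and [L <= <V, V>] by Cauchy-Schwarz
  ([sqr_avg_block_mean_le]).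
- If [p] is much smaller than [q], then [v_q] is almost invariant under each
  [T^h] with [h <= p], whence [<T^h u, v_q> ~ <T^h u, T^h v_q> = <u, v_q>].
  Averaging over [h], [<v_p, v_q>] is at most the [q]-th Cesaro mean of [c],
  up to [O(p / q)] ([corr_block_le]).
- So in [<V, V>], which is a mean over the [k ^ 2] pairs of blocks, all
  off-diagonal pairs contribute at most [l + d] with [d] small, and the [k]
  diagonal ones contribute [O(1 / k)] ([block_mean_sqr_le]).

Letting [k] grow and [d] shrink gives [L <= l] ([sqr_avg_le_cesaro_corr]), for
every real [l] above the liminf of the Cesaro means.  The upper mean is not
linear, but the argument only bounds it from above, by monotonicity,
subadditivity and shift invariance. *)

(** * Finite averages *)

Section Averages.
Variable R : realType.
Implicit Types (f g x y c : nat -> R) (N k : nat).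

Definition avg N f : R := N%:R^-1 * \sum_(1 <= n < N.+1) f n.

Lemma avg0 f : avg 0 f = 0.
Proof. by rewrite /avg invr0 mul0r. Qed.

Lemma ler_avg N f g :
  (forall n, (0 < n <= N)%N -> f n <= g n) -> avg N f <= avg N g.
Proof.
move=> fg; rewrite ler_wpM2l ?invr_ge0//.
by rewrite big_nat [leRHS]big_nat; apply: ler_sum => n /fg.
Qed.

Lemma eq_avg N f g :
  (forall n, (0 < n <= N)%N -> f n = g n) -> avg N f = avg N g.
Proof. by move=> fg; congr (_ * _); apply: eq_big_nat => n /fg. Qed.

Lemma avg_cst N (a : R) : (0 < N)%N -> avg N (fun=> a) = a.
Proof.
move=> N0; rewrite /avg sumr_const_nat subSS subn0 -(mulr_natl a) mulrA.
by rewrite mulVf ?mul1r// pnatr_eq0 -lt0n.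
Qed.

Lemma avgD N f g : avg N (fun n => f n + g n) = avg N f + avg N g.
Proof. by rewrite /avg big_split mulrDr. Qed.

Lemma avgB N f g : avg N (fun n => f n - g n) = avg N f - avg N g.
Proof. by rewrite /avg sumrB mulrBr. Qed.

Lemma avgZl N (a : R) f : avg N (fun n => a * f n) = a * avg N f.
Proof. by rewrite /avg -mulr_sumr mulrCA. Qed.

Lemma avgZr N (a : R) f : avg N (fun n => f n * a) = avg N f * a.
Proof. by rewrite /avg -mulr_suml mulrA. Qed.

Lemma exchange_avg N k (F : nat -> nat -> R) :
  avg N (fun n => avg k (F n)) = avg k (fun m => avg N (F^~ m)).
Proof.
rewrite /avg -!mulr_sumr mulrCA; congr (_ * (_ * _)).
exact: exchange_big_nat.
Qed.

Lemma avgM N k f g :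
  avg N f * avg k g = avg N (fun n => avg k (fun m => f n * g m)).
Proof. by rewrite -avgZr; apply: eq_avg => n _; rewrite avgZl. Qed.

Lemma ler_norm_avg N f : `|avg N f| <= avg N (fun n => `|f n|).
Proof.
rewrite /avg normrM ger0_norm ?invr_ge0//.
by rewrite ler_wpM2l ?invr_ge0// ler_norm_sum.
Qed.

Lemma norm_avg_le N f (M : R) : 0 <= M ->
  (forall n, (0 < n)%N -> `|f n| <= M) -> `|avg N f| <= M.
Proof.
case: N => [|N] M0 fM; first by rewrite avg0 normr0.
rewrite (le_trans (ler_norm_avg _ _))// -[leRHS](@avg_cst N.+1)//.
by apply: ler_avg => n /andP[n0 _]; exact: fM.
Qed.

(** The variance is nonnegative. *)
Lemma sqr_avg_le N f : avg N f ^+ 2 <= avg N (fun n => f n ^+ 2).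
Proof.
case: N => [|N]; first by rewrite !avg0 expr0n.
have : 0 <= avg N.+1 (fun n => (f n - avg N.+1 f) ^+ 2).
  by rewrite mulr_ge0 ?invr_ge0// sumr_ge0// => n _; rewrite sqr_ge0.
set m := avg _ f.
rewrite (eq_avg (g := fun n => f n ^+ 2 + (- (2 * m) * f n + m ^+ 2))); last first.
  by move=> n _; ring.
by rewrite !avgD avgZl avg_cst// -/m; nra.
Qed.

(** The two sums differ by [h] terms at each end; each unit shift changes the
average by [(f (N + 1) - f 1) / N], by telescoping. *)
Lemma norm_avg_shift N f (M : R) h :
  (forall n, (0 < n)%N -> `|f n| <= M) ->
  `|avg N (fun n => f (n + h)%N) - avg N f| <= 2 * M * h%:R / N%:R.
Proof.
move=> fM; elim: h => [|h ih].
  by rewrite mulr0 mul0r; under eq_avg do rewrite addn0; rewrite subrr normr0.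
rewrite -(@natr1 R h) mulrDr mulr1 mulrDl [leRHS]addrC.
rewrite -[avg N _](subrK (avg N (fun n => f (n + h)%N))) -addrA.
rewrite (le_trans (ler_normD _ _))//; apply: lerD => //; rewrite -avgB /avg.
under eq_bigr do rewrite addnS -addSn.
rewrite (telescope_sumr (fun n => f (n + h)%N))// normrM ger0_norm ?invr_ge0//.
rewrite mulrC ler_wpM2r ?invr_ge0// (le_trans (ler_normB _ _))//.
by rewrite mulr_natl mulr2n lerD// fM.
Qed.

End Averages.

(** * Upper limits of real sequences *)

Section UpperLimits.
Variable R : realType.
Implicit Types (a b c : nat -> R) (l m : R).

(** The real-valued form of [limsup a <= l], which makes sense without knowing
that the limsup is finite and avoids sums of extended reals. *)
Definition limsup_le a l :=
  forall e : R, 0 < e -> \forall N \near \oo%classic, a N <= l + e.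

Lemma limsup_leP a l :
  limsup_le a l <-> (limn_esup (fun N => (a N)%:E) <= l%:E)%E.
Proof.
split=> [al|al e e0].
- apply/lee_addgt0Pr => e /al ale; apply: ge_ereal_inf.
  exists (ereal_sup [set (a N)%:E | N in [set N | a N <= l + e]]%classic).
    by exists [set N | a N <= l + e]%classic.
  by apply: ge_ereal_sup => _ [N /= aN <-]; rewrite -EFinD lee_fin.
- have /ereal_inf_lt[_ [V Voo <-] supV] : (limn_esup (fun N => (a N)%:E) < (l + e)%:E)%E.
    by rewrite (le_lt_trans al)// lte_fin ltrDl.
  apply: filterS Voo => N VN; rewrite -lee_fin (le_trans _ (ltW supV))//.
  by apply: ereal_sup_ubound; exists N.
Qed.

Lemma limn_esup_fin_num a m :
  (forall N, `|a N| <= m) -> limn_esup (fun N => (a N)%:E) \is a fin_num.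
Proof.
move=> am; rewrite fin_real//; apply/andP; split.
- rewrite (@lt_le_trans _ _ (- m)%:E)// ?ltNyr//.
  apply/ereal_infP => _ [V Voo <-]; have [N VN] := filter_ex Voo.
  rewrite (@le_trans _ _ (a N)%:E)//.
    by have := am N; rewrite ler_norml lee_fin => /andP[].
  by apply: ereal_sup_ubound; exists N.
- rewrite (@le_lt_trans _ _ m%:E)// ?ltry//; apply/limsup_leP => e e0.
  by near=> N; rewrite (le_trans (ler_norm _))// (le_trans (am N))// lerDl ltW.
Unshelve. all: by end_near. Qed.

(** This is the form in which the liminf enters the choice of block lengths. *)
Lemma limn_einf_lt_frequently b l :
  (limn_einf (fun J => (b J)%:E) < l%:E)%E ->
  forall p : nat, exists2 J, (p <= J)%N & b J <= l.
Proof.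
move=> bl p; apply: contrapT => nb; move: bl; apply/negP; rewrite -leNgt.
rewrite /limn_einf leeNr -EFinN.
have : limsup_le (fun J => - b J) (- l).
  move=> e e0; near=> J; rewrite (@le_trans _ _ (- l))//; last by rewrite lerDl ltW.
  rewrite lerN2 leNgt; apply/negP => /ltW bJ; apply: nb; exists J => //.
  by near: J; exact: nbhs_infty_ge.
by move/limsup_leP.
Unshelve. all: by end_near. Qed.

(** Every error made below by changing the ends of an average is [C / N]. *)
Lemma limsup_le_bigO a b l (C : R) :
  (forall N, b N <= a N + C / N%:R) -> limsup_le a l -> limsup_le b l.
Proof.
move=> ba al e e0; have e20 : 0 < e / 2 by rewrite divr_gt0.
near=> N; rewrite (le_trans (ba N))// [in leRHS](splitr e) addrA lerD//.
  by near: N; exact: al.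
have N0 : 0 < N%:R :> R by rewrite ltr0n; near: N; exact: nbhs_infty_gt.
rewrite ler_pdivrMr// mulrC -ler_pdivrMr//.
by near: N; exact: nbhs_infty_ger.
Unshelve. all: by end_near. Qed.

Lemma limsup_le_le a b l : (forall N, b N <= a N) -> limsup_le a l -> limsup_le b l.
Proof.
by move=> ba; apply: (@limsup_le_bigO _ _ _ 0) => N; rewrite mul0r addr0.
Qed.

Lemma limsup_le_trans a l m : l <= m -> limsup_le a l -> limsup_le a m.
Proof.
by move=> lm al e /al; apply: filterS => N /le_trans; apply; rewrite lerD2r.
Qed.

Lemma limsup_leD a b l m :
  limsup_le a l -> limsup_le b m -> limsup_le (fun N => a N + b N) (l + m).
Proof.
move=> al bm e e0; have e20 : 0 < e / 2 by rewrite divr_gt0.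
near=> N; rewrite [in leRHS](splitr e) addrACA lerD//.
- by near: N; exact: al.
- by near: N; exact: bm.
Unshelve. all: by end_near. Qed.

Lemma limsup_leDr a l m : limsup_le a l -> limsup_le (fun N => a N + m) (l + m).
Proof.
by move=> al e /al; apply: filterS => N aN; rewrite addrAC lerD2r.
Qed.

Lemma limsup_leZ (t : R) a l :
  0 < t -> limsup_le a l -> limsup_le (fun N => t * a N) (t * l).
Proof.
move=> t0 al e e0; have /al : 0 < e / t by rewrite divr_gt0.
apply: filterS => N; rewrite -(ler_pM2l t0) mulrDr mulrCA divff ?mulr1//.
exact: lt0r_neq0.
Qed.

Lemma limsup_le_avg k (A : nat -> nat -> R) c :
  (forall i, (0 < i <= k)%N -> limsup_le (A i) (c i)) ->
  limsup_le (fun N => avg k (A^~ N)) (avg k c).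
Proof.
case: k => [|k] Ac.
  by move=> e /ltW e0; near=> N; rewrite !avg0 add0r.
apply: limsup_leZ; first by rewrite invr_gt0 ltr0n.
elim: {-2}k (leqnn k) => [|j ih] jk.
  move=> e e0; have := Ac 1%N isT e e0; apply: filterS => N.
  by rewrite !big_nat1.
rewrite big_nat_recr//=.
apply: (@limsup_le_le (fun N => \sum_(1 <= n < j.+2) A n N + A j.+2 N)) => [N|].
  by rewrite [leLHS]big_nat_recr.
by apply: limsup_leD; [apply: ih; exact: ltnW|exact: Ac].
Unshelve. all: by end_near. Qed.

End UpperLimits.

(** * Averages of shifts *)

Section BlockMeans.
Variable R : realType.
Implicit Types (x y c : nat -> R).

(** The sequence [V] of the introductory comment, for the block lengths
[J 1, ..., J k]. *)
Definition block_mean k (J : nat -> nat) x n : R :=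
  avg k (fun i => avg (J i) (fun h => x (n + h)%N)).

Lemma avg_block_mean_approx k (J : nat -> nat) x (M : R) :
  (0 < k)%N -> (forall i, (0 < J i)%N) -> 0 <= M ->
  (forall n, (0 < n)%N -> `|x n| <= M) ->
  forall N, `|avg N x - avg N (block_mean k J x)|
    <= avg k (fun i => 2 * M * (J i)%:R) / N%:R.
Proof.
move=> k0 J0 M0 xM N; rewrite distrC /block_mean exchange_avg.
rewrite -{1}(avg_cst (avg N x) k0) -avgB (le_trans (ler_norm_avg _ _))//.
rewrite -avgZr; apply: ler_avg => i _.
rewrite exchange_avg -{1}(avg_cst (avg N x) (J0 i)) -avgB.
rewrite (le_trans (ler_norm_avg _ _))//.
rewrite -[leRHS](avg_cst _ (J0 i)); apply: ler_avg => h /andP[_ hJ].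
rewrite (le_trans (norm_avg_shift _ _ xM))// ler_wpM2r ?invr_ge0//.
by rewrite ler_wpM2l ?mulr_ge0// ler_nat.
Qed.

(** Combines the [O(1 / N)] distance between the means of [x] and of its block
mean with Cauchy-Schwarz for the latter. *)
Lemma sqr_avg_block_mean_le k (J : nat -> nat) x (M : R) :
  (0 < k)%N -> (forall i, (0 < J i)%N) -> 0 <= M ->
  (forall n, (0 < n)%N -> `|x n| <= M) ->
  exists C : R, forall N,
    avg N x ^+ 2 <= avg N (fun n => block_mean k J x n ^+ 2) + C / N%:R.
Proof.
move=> k0 J0 M0 xM.
have wM n : (0 < n)%N -> `|block_mean k J x n| <= M.
  move=> n0; apply: norm_avg_le => // i _; apply: norm_avg_le => // h _.
  by apply: xM; rewrite addn_gt0 n0.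
exists (2 * M * avg k (fun i => 2 * M * (J i)%:R)) => N.
have := avg_block_mean_approx k0 J0 M0 xM N.
have := norm_avg_le N M0 xM; have := norm_avg_le N M0 wM.
have := sqr_avg_le N (block_mean k J x).
set X := avg N x; set W := avg N _; set D := _ / N%:R => W2 WM XM XW.
rewrite -mulrA -/D (le_trans _ (lerD W2 (lexx _)))//.
rewrite -lerBlDl subr_sqr mulrC (le_trans (ler_norm _))// normrM.
rewrite ler_pM// (le_trans (ler_normD _ _))// mulr_natl mulr2n lerD//.
Qed.

(** [Re (u m * (u n)^* )] for [u = x + i y]. *)
Definition corr x y (m n : nat) : R := x m * x n + y m * y n.

Lemma norm_corr_le x y (M : R) m n :
  (forall n, (0 < n)%N -> `|x n| <= M) -> (forall n, (0 < n)%N -> `|y n| <= M) ->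
  (0 < m)%N -> (0 < n)%N -> `|corr x y m n| <= M * M + M * M.
Proof.
move=> xM yM m0 n0; rewrite (le_trans (ler_normD _ _))// !normrM.
by rewrite lerD// ler_pM// ?xM ?yM.
Qed.

Lemma sqr_block_mean k (J : nat -> nat) x y n :
  block_mean k J x n ^+ 2 + block_mean k J y n ^+ 2 =
  avg k (fun i => avg k (fun l => avg (J i) (fun h => avg (J l) (fun g =>
    corr x y (n + h) (n + g))))).
Proof.
rewrite !expr2 /block_mean !avgM -avgD; apply: eq_avg => i _.
rewrite -avgD; apply: eq_avg => l _.
rewrite !avgM -avgD; apply: eq_avg => h _.
by rewrite -avgD.
Qed.

Section Correlations.
Variables (x y c : nat -> R) (B : R).
Hypothesis B0 : 0 <= B.
Hypothesis corrB :
  forall m n, (0 < m)%N -> (0 < n)%N -> `|corr x y m n| <= B.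
Hypothesis corr_le : forall j, (0 < j)%N ->
  limsup_le (fun N => avg N (fun n => corr x y n (n + j))) (c j).

(** Almost invariance of long averages of shifts.  For [h <= p], replacing
[u (n + g)] by [u (n + h + g)] in an average over [g <= q] costs
[2 B h / q <= 2 B p / q]; what remains is the [h]-shift of [F], whose mean in
[n] is asymptotically that of [F], and the latter is an average of
correlations. *)
Lemma corr_block_le p q : (0 < p)%N -> (0 < q)%N ->
  limsup_le
    (fun N => avg N (fun n => avg p (fun h => avg q (fun g =>
       corr x y (n + h) (n + g)))))
    (avg q c + 2 * B * p%:R / q%:R).
Proof.
move=> p0 q0; set E := _ / _.
pose F n := avg q (fun g => corr x y n (n + g)).
have FB n : (0 < n)%N -> `|F n| <= B.
  move=> n0; apply: norm_avg_le => // g _.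
  by apply: corrB => //; rewrite addn_gt0 n0.
have FU : limsup_le (fun N => avg N F) (avg q c).
  apply: (@limsup_le_le _ (fun N => avg q (fun g => avg N (fun n => corr x y n (n + g))))).
    by move=> N; rewrite -exchange_avg.
  by apply: limsup_le_avg => j /andP[j0 _]; exact: corr_le.
(* The error [E] made by shifting in [g] is kept as a constant, and the shift
   in [n] is absorbed in the [O(1 / N)] term. *)
have FhU : limsup_le (fun N => avg N F + E) (avg q c + E) by exact: limsup_leDr.
apply: (limsup_le_bigO (C := 2 * B * p%:R) _ FhU) => N.
rewrite exchange_avg -[leRHS](avg_cst _ p0); apply: ler_avg => h /andP[h0 hp].
apply: (@le_trans _ _ (avg N (fun n => F (n + h)%N + E))).
  apply: ler_avg => n /andP[n0 _].
  have /(norm_avg_shift q h) : forall g, (0 < g)%N -> `|corr x y (n + h) (n + g)| <= B.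
    by move=> g g0; apply: corrB; rewrite addn_gt0 n0.
  rewrite ler_norml => /andP[+ _]; rewrite lerNl opprB lerBlDl.
  move=> /le_trans; apply; rewrite lerD//; last first.
    by rewrite ler_wpM2r ?invr_ge0// ler_wpM2l ?mulr_ge0// ler_nat.
  by apply: ler_avg => g _; rewrite addnA addnAC.
case: N => [|N]; first by rewrite !avg0 invr0 mulr0 addr0 add0r /E !mulr_ge0 ?invr_ge0.
rewrite avgD avg_cst// addrAC lerD2r.
have := norm_avg_shift N.+1 h FB; rewrite ler_norml => /andP[_].
rewrite lerBlDl => /le_trans; apply; rewrite lerD2l.
by rewrite ler_wpM2r ?invr_ge0// ler_wpM2l ?mulr_ge0// ler_nat.
Qed.

Lemma corr_sym m n : corr x y m n = corr x y n m.
Proof. by rewrite /corr [x m * _]mulrC [y m * _]mulrC. Qed.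

(** The near-orthogonality estimate: the [k] diagonal pairs among [k ^ 2] are
bounded trivially by [B], which exceeds [l] by at most [B + |l|]. *)
Lemma block_mean_sqr_le k (J : nat -> nat) (l d : R) : (0 < k)%N -> 0 <= d ->
  (forall i, (0 < J i)%N) -> (forall i, avg (J i) c <= l) ->
  (forall i j, (i < j)%N -> 2 * B * (J i)%:R / (J j)%:R <= d) ->
  limsup_le
    (fun N => avg N (fun n => block_mean k J x n ^+ 2 + block_mean k J y n ^+ 2))
    (l + d + (B + `|l|) / k%:R).
Proof.
move=> k0 d0 J0 Jl Jd; set D := B + `|l|.
have D0 : 0 <= D by rewrite addr_ge0.
pose G i j n := avg (J i) (fun h => avg (J j) (fun g => corr x y (n + h) (n + g))).
have Goff i j : (i < j)%N -> limsup_le (fun N => avg N (G i j)) (l + d).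
  move=> ij; apply: limsup_le_trans (corr_block_le (J0 i) (J0 j)).
  by rewrite lerD// Jd.
have Gle i j : limsup_le (fun N => avg N (G i j)) (l + d + D * (j == i)%:R).
  case: (ltngtP j i) => [ji|ij|->]; rewrite ?mulr0 ?addr0 ?mulr1.
  (* The longer block comes first here: exchange the blocks. *)
  - apply: limsup_le_le (Goff _ _ ji) => N; apply: ler_avg => n _.
    rewrite /G exchange_avg le_eqVlt; apply/orP; left; apply/eqP.
    by apply: eq_avg => h _; apply: eq_avg => g _; exact: corr_sym.
  - exact: Goff.
  - move=> e e0; near=> N; rewrite (@le_trans _ _ B)//; last first.
      rewrite /D; have := ler_norm (- l); rewrite normrN; lra.
    rewrite (le_trans (ler_norm _))//; apply: norm_avg_le => // n n0.
    do 2 (apply: norm_avg_le => // ? ?).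
    by apply: corrB; rewrite addn_gt0 n0.
apply: (@limsup_le_le _ (fun N => avg k (fun i => avg k (fun j => avg N (G i j))))).
  move=> N; under [leLHS]eq_avg do rewrite sqr_block_mean.
  rewrite exchange_avg; apply: ler_avg => i _.
  by rewrite exchange_avg.
apply: (@limsup_le_trans _ _ (avg k (fun i => avg k (fun j => l + d + D * (j == i)%:R)))).
  rewrite -[leRHS](avg_cst _ k0); apply: ler_avg => i /andP[i0 ik].
  rewrite avgD avg_cst// lerD2l avgZl ler_wpM2l// /avg.
  rewrite (bigD1_seq i) ?mem_index_iota ?i0 ?iota_uniq//= eqxx big1 ?addr0 ?mulr1//.
  by move=> j /negPf ->.
apply: (@limsup_le_avg _ _ (fun i N => avg k (fun j => avg N (G i j)))) => i _.
exact: (@limsup_le_avg _ _ (fun j N => avg N (G i j))).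
Unshelve. all: by end_near. Qed.

End Correlations.

Lemma lacunary_subsequence (P : nat -> Prop) (q : nat) :
  (forall p, exists2 J, (p <= J)%N & P J) ->
  exists J : nat -> nat, [/\ forall i, (0 < J i)%N, forall i, P (J i) &
    forall i j, (i < j)%N -> (q * J i <= J j)%N].
Proof.
move=> Pinf.
have /choice[f fP] p : exists J, (p <= J)%N /\ P J.
  by have [J] := Pinf p; exists J.
pose J := fix J i := if i is i'.+1 then f (q.+1 * J i').+1 else f 1%N.
(* The factor [q.+1], rather than [q], makes [J] nondecreasing even if [q = 0]. *)
have J0 i : (0 < J i)%N by case: i => [|i]; apply: leq_trans (proj1 (fP _)).
have JS i : (q.+1 * J i <= J i.+1)%N by apply: leq_trans (proj1 (fP _)).
exists J; split=> // [[|i]|i j]; [exact: (fP _).2|exact: (fP _).2|].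
elim: j => // j ih; rewrite ltnS leq_eqVlt => /predU1P[->|/ih qJ].
  by rewrite (leq_trans _ (JS j))// leq_mul.
by rewrite (leq_trans qJ)// (leq_trans _ (JS j))// leq_pmull.
Qed.

(** For every [d], enough blocks whose lengths have large enough ratios make
both error terms of [block_mean_sqr_le] at most [d]. *)
Lemma sqr_avg_le_cesaro_corr x y c (M l : R) :
  (forall n, (0 < n)%N -> `|x n| <= M) -> (forall n, (0 < n)%N -> `|y n| <= M) ->
  (forall j, (0 < j)%N ->
    limsup_le (fun N => avg N (fun n => corr x y n (n + j))) (c j)) ->
  (forall p, exists2 J, (p <= J)%N & avg J c <= l) ->
  limsup_le (fun N => avg N x ^+ 2 + avg N y ^+ 2) l.
Proof.
move=> xM yM xyc cl.
have M0 : 0 <= M by rewrite (le_trans _ (xM 1%N isT)).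
pose B' := M * M + M * M.
have B0 : 0 <= B' by rewrite addr_ge0// mulr_ge0.
have corrB m n : (0 < m)%N -> (0 < n)%N -> `|corr x y m n| <= B'.
  exact: norm_corr_le.
suff main d : 0 < d -> limsup_le (fun N => avg N x ^+ 2 + avg N y ^+ 2) (l + d + d).
  move=> e e0; have e40 : 0 < e / 4 by rewrite divr_gt0.
  have e20 : 0 < e / 2 by rewrite divr_gt0.
  by apply: filterS (main _ e40 _ e20) => N; lra.
move=> d0.
have large (r : R) : exists2 k, (0 < k)%N & r <= k%:R.
  have [k [k0 rk]] := filter_ex (filterI (nbhs_infty_gt 0) (nbhs_infty_ger r)).
  by exists k.
(* [k] makes the diagonal contribution at most [d], and the gap ratio [q] makes
   the shift error [2 B' (J i) / (J j)] at most [d]. *)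
have [k k0 kd] := large ((B' + `|l|) / d).
have [q q0 qd] := large (2 * B' / d).
have [J [J0 Jl Jq]] := lacunary_subsequence q cl.
have Jd i j : (i < j)%N -> 2 * B' * (J i)%:R / (J j)%:R <= d.
  move=> /Jq; rewrite -(ler_nat R) natrM => qJ.
  rewrite ler_pdivrMr ?ltr0n// (le_trans _ (ler_wpM2l (ltW d0) qJ))//.
  by rewrite mulrA ler_wpM2r// [leRHS]mulrC -ler_pdivrMr.
have W := block_mean_sqr_le B0 corrB xyc k0 (ltW d0) J0 Jl Jd.
have {}W := limsup_le_trans _ W.
have [Cx xC] := sqr_avg_block_mean_le k0 J0 M0 xM.
have [Cy yC] := sqr_avg_block_mean_le k0 J0 M0 yM.
apply: (limsup_le_bigO (C := Cx + Cy) _ (W _ _)) => [N|].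
- by rewrite avgD mulrDl addrACA lerD.
- by rewrite lerD2l ler_pdivrMr ?ltr0n// [leRHS]mulrC -ler_pdivrMr.
Qed.

End BlockMeans.

(** * Complex sequences *)

Lemma Re_Im_normc_le (R : realType) (z : R[i]) :
  `|complex.Re z| <= ComplexField.Normc.normc z /\
  `|complex.Im z| <= ComplexField.Normc.normc z.
Proof.
by case: z => a b /=; split; rewrite -sqrtr_sqr ler_wsqrtr// ?lerDl ?lerDr sqr_ge0.
Qed.

Lemma Re_mul_conj (R : realType) (z w : R[i]) :
  complex.Re (z * w^*) =
  complex.Re z * complex.Re w + complex.Im z * complex.Im w.
Proof. by case: z w => a b [c d] /=; rewrite mulrN opprK. Qed.

Lemma normc_mean_sqr (R : realType) (u : nat -> R[i]) N :
  ComplexField.Normc.normc (N%:R^-1 * \sum_(1 <= n < N.+1) u n) ^+ 2 =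
  avg N (fun n => complex.Re (u n)) ^+ 2 + avg N (fun n => complex.Im (u n)) ^+ 2.
Proof.
have -> : N%:R^-1 * \sum_(1 <= n < N.+1) u n =
    (avg N (fun n => complex.Re (u n)) +i* avg N (fun n => complex.Im (u n)))%C.
  have -> : N%:R^-1 = (N%:R^-1)%:C%C :> R[i] by rewrite fmorphV rmorph_nat.
  have -> : \sum_(1 <= n < N.+1) u n =
    ((\sum_(1 <= n < N.+1) complex.Re (u n)) +i*
     (\sum_(1 <= n < N.+1) complex.Im (u n)))%C.
    elim: (index_iota 1 N.+1) => [|n s ih]; rewrite ?big_nil// !big_cons ih.
    by case: (u n).
  by rewrite /avg; apply/eqP; rewrite eq_complex /= !mul0r subr0 addr0 !eqxx.
by rewrite /= sqr_sqrtr// addr_ge0// sqr_ge0.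
Qed.

Theorem theorem2p1 (R : realType) (u : nat -> R[i])
  (hu : exists M : R, forall n : nat, (0 < n)%N -> ComplexField.Normc.normc (u n) <= M) :
  (limn_esup (fun N : nat =>
     ((ComplexField.Normc.normc (N%:R^-1 * \sum_(1 <= n < N.+1) u n)) ^+ 2)%:E)
   <=
   limn_einf (fun J : nat =>
     (J%:R^-1)%:E * \sum_(1 <= j < J.+1)
       limn_esup (fun N : nat =>
         (N%:R^-1 * \sum_(1 <= n < N.+1) complex.Re (u n * (u (n + j)%N)^*))%:E)))%E.
Proof.
have [M uM] := hu.
pose x n := complex.Re (u n); pose y n := complex.Im (u n).
have xM n : (0 < n)%N -> `|x n| <= M.
  by move=> /uM; apply: le_trans; case: (Re_Im_normc_le (u n)).
have yM n : (0 < n)%N -> `|y n| <= M.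
  by move=> /uM; apply: le_trans; case: (Re_Im_normc_le (u n)).
pose a j N := avg N (fun n => corr x y n (n + j)).
pose c j := fine (limn_esup (fun N => (a j N)%:E)).
have M0 : 0 <= M by rewrite (le_trans _ (xM 1%N isT)).
have cE j : limn_esup (fun N => (a j N)%:E) = (c j)%:E.
  rewrite fineK//; apply: (@limn_esup_fin_num _ _ (M * M + M * M)) => N.
  by apply: norm_avg_le => [|n n0]; [rewrite addr_ge0// mulr_ge0|apply: norm_corr_le => //; rewrite addn_gt0 n0].
have -> : (fun J : nat => (J%:R^-1)%:E * \sum_(1 <= j < J.+1)
    limn_esup (fun N : nat =>
      (N%:R^-1 * \sum_(1 <= n < N.+1) complex.Re (u n * (u (n + j)%N)^*))%:E))%E =
    (fun J => (avg J c)%:E).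
  apply/funext => J; rewrite /avg EFinM -sumEFin; congr (_ * _)%E.
  apply: eq_bigr => j _; rewrite -cE; congr limn_esup; apply/funext => N.
  by congr (_%:E); apply: eq_avg => n _; rewrite Re_mul_conj.
have -> : (fun N : nat =>
    (ComplexField.Normc.normc (N%:R^-1 * \sum_(1 <= n < N.+1) u n) ^+ 2)%:E) =
    (fun N => (avg N x ^+ 2 + avg N y ^+ 2)%:E).
  by apply/funext => N; rewrite normc_mean_sqr.
have ac j : limsup_le (a j) (c j) by apply/limsup_leP; rewrite cE.
have /fineK LE : limn_esup (fun N => (avg N x ^+ 2 + avg N y ^+ 2)%:E) \is a fin_num.
  apply: (@limn_esup_fin_num _ _ (M * M + M * M)) => N.
  rewrite (le_trans (ler_normD _ _))// !normrX !expr2.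
  by rewrite lerD// ler_pM// norm_avg_le.
rewrite leNgt; apply/negP; rewrite -LE; set L := fine _ => bL.
(* An intermediate real is chosen by cases, as the liminf is not yet known to
   be finite. *)
have [l bl lL] : exists2 l : R, (limn_einf (fun J => (avg J c)%:E) < l%:E)%E & l < L.
  case: limn_einf bL => [r|//|_].
    by rewrite lte_fin => rL; exists ((r + L) / 2); rewrite ?lte_fin midf_lt.
  by exists (L - 1); rewrite ?ltNyr// ltrBlDr ltrDl.
have := sqr_avg_le_cesaro_corr xM yM (fun j _ => ac j) (limn_einf_lt_frequently bl).
by move/limsup_leP; rewrite -LE lee_fin leNgt lL.
Qed.
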